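(* Let $b>1$ be real. Then $$\pi=\frac{2(b^2-1)^2}{\sqrt{b^4-1}}\;\frac{K\!\left(\dfrac{2b}{1+b^2}\right)}{\sqrt{b^4-1}-F_1\!\left(\tfrac12;1,\tfrac12;2\,\Big|\,\dfrac1{1-b^2},\dfrac1{1-b^4}\right)}.$$
   Context: $K(k)=\int_0^1\frac{dx}{\sqrt{(1-x^2)(1-k^2x^2)}}$ is the complete elliptic integral of the first kind, as a function of the modulus $k$. The two-variable Appell function is $F_1(\alpha;\beta_1,\beta_2;\gamma\,|\,x,y)=\sum_{m,n\ge0}\frac{(\alpha)_{m+n}(\beta_1)_m(\beta_2)_n}{(\gamma)_{m+n}\,m!\,n!}x^my^n$ for $|x|,|y|<1$, with $(x)_k$ the Pochhammer symbol. For $\operatorname{Re}\gamma>\operatorname{Re}\alpha>0$ it equals, and outside the region of convergence is defined by analytic continuation through, $\frac{\Gamma(\gamma)}{\Gamma(\alpha)\Gamma(\gamma-\alpha)}\int_0^1\frac{u^{\alpha-1}(1-u)^{\gamma-\alpha-1}}{(1-xu)^{\beta_1}(1-yu)^{\beta_2}}\,du$ (principal branches, $x,y\notin[1,\infty)$). *)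

(* Defs.v *)
From HB Require Import structures.
From mathcomp Require Import all_boot all_order all_algebra.
From mathcomp Require Import all_classical all_reals all_analysis.

Set Implicit Arguments.
Unset Strict Implicit.
Unset Printing Implicit Defensive.

Import Order.TTheory GRing.Theory Num.Theory.
Import numFieldNormedType.Exports.

Local Open Scope classical_set_scope.
Local Open Scope ring_scope.

(* As a function of the modulus k, for `|k| < 1. The singularity of the
   integrand at x = 1 is a null set for the Lebesgue integral. *)
Definition ellipticK (R : realType) (k : R) : R :=
  \int[lebesgue_measure]_(x in `[0, 1])
    (Num.sqrt ((1 - x ^+ 2) * (1 - k ^+ 2 * x ^+ 2)))^-1.

(* Euler's integral, for 0 < s. *)
Definition Gamma (R : realType) (s : R) : R :=
  \int[lebesgue_measure]_(t in `[0, +oo[) (t `^ (s - 1) * expR (- t)).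

Definition pochhammer (R : realType) (a : R) (k : nat) : R :=
  \prod_(i < k) (a + i%:R).

(* Absolutely convergent when `|x| < 1 and `|y| < 1, so the iterated sum is
   the sum of the double series. *)
Definition appellF1_series (R : realType) (alpha beta1 beta2 gamma x y : R) : R :=
  limn (series (fun m : nat => limn (series (fun n : nat =>
    pochhammer alpha (m + n) * pochhammer beta1 m * pochhammer beta2 n
    / (pochhammer gamma (m + n) * m`!%:R * n`!%:R) * x ^+ m * y ^+ n)))).

(* For 0 < alpha < gamma and real x, y < 1, where the bases 1 - x u and
   1 - y u are positive and the principal powers are the real ones. *)
Definition appellF1_integral (R : realType) (alpha beta1 beta2 gamma x y : R) : R :=
  Gamma gamma / (Gamma alpha * Gamma (gamma - alpha)) *
  \int[lebesgue_measure]_(u in `[0, 1])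
    (u `^ (alpha - 1) * (1 - u) `^ (gamma - alpha - 1)
     / ((1 - x * u) `^ beta1 * (1 - y * u) `^ beta2)).

(* The series on its region of convergence, and its continuation through the
   integral elsewhere. *)
Definition appellF1 (R : realType) (alpha beta1 beta2 gamma x y : R) : R :=
  if (`|x| < 1) && (`|y| < 1)
  then appellF1_series alpha beta1 beta2 gamma x y
  else appellF1_integral alpha beta1 beta2 gamma x y.

(* Main.v *)
Require Import Defs.
From HB Require Import structures.
From mathcomp Require Import all_boot all_order all_algebra.
From mathcomp Require Import all_classical all_reals all_analysis.
From mathcomp Require Import measurable_realfun ring lra.
Import Order.TTheory GRing.Theory Num.Theory.
Import numFieldNormedType.Exports.

(** Put k = b^-2, so that 0 < k < 1, write s = sin t, c = cos t and
D = sqrt (1 - k^2 s^2), and let J be the integral of 1 / D over [0, pi/2], which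
is K(k).  Both sides of the formula are expressed through J.

The modulus 2 b / (1 + b^2) is 2 sqrt k / (1 + k), so the Landen transformation
x = (1 + k) s / (1 + k s^2) gives K(2 b / (1 + b^2)) = (1 + k) J
([ellipticK_landen]).

The substitution u = s^2 in Euler's integral, together with the values of Gamma
at 1/2, 3/2 and 2, gives
  F1(x, y) = 4/pi * integral of c^2 / ((1 - x s^2) sqrt (1 - y s^2)) over [0, pi/2]
([appellF1_integral_trig]).  For b^2 > 2 the arguments are in the bidisc, where
F1 is the sum of its double series; the same formula holds there
([appellF1_series_trig]) because (1/2)_n / (2)_n is the n-th moment of s^2 for the
weight 4/pi * c^2 ([wallis_moment]), and the sums under the integral are a
binomial series in y s^2 and a geometric series in x s^2, both converging
uniformly in t.

At x = 1 / (1 - b^2) and y = 1 / (1 - b^4), replacing t by pi/2 - t turns this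
integral into a combination of complete elliptic integrals of modulus k, of the
first kind and of the third kind with characteristic k.  For this characteristic
the third kind is not a new transcendent:
  (1 - k) (1 + k s^2) / ((1 - k s^2) D)
is the derivative of 2 atan ((1 - k) s / (1 - k s^2 + c D)), which goes from 0 to
pi/2 ([Rintegral_Pi_special]).  Hence
  F1 = sqrt (b^4 - 1) (1 - 2/pi * (1 - k) J)
([appellF1_elliptic]), the denominator of the formula is
sqrt (b^4 - 1) * 2/pi * (1 - k) J, the positive factor J cancels, and an identity
between rational functions of b remains. *)

Set Implicit Arguments.
Unset Strict Implicit.

Local Open Scope classical_set_scope.
Local Open Scope ring_scope.

(** * Continuity, derivatives and integrals of explicit real functions *)

Section Calculus.
Context {R : realType}.
Implicit Types f g F : R -> R.

(** The closure properties below are stated for explicit functions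
[fun x => _], the form in which the integrands of this file are given, so that
they apply by unification. *)
Lemma continuous_fun_cst (c : R) : continuous (fun _ : R => c).
Proof. by move=> x; exact: cvg_cst. Qed.

Lemma continuous_fun_id : continuous (fun x : R => x).
Proof. by move=> x; exact: cvg_id. Qed.

Lemma continuous_funD f g :
  continuous f -> continuous g -> continuous (fun x => f x + g x).
Proof. by move=> cf cg x; apply: cvgD; [exact: cf|exact: cg]. Qed.

Lemma continuous_funN f : continuous f -> continuous (fun x => - f x).
Proof. by move=> cf x; apply: cvgN; exact: cf. Qed.

Lemma continuous_funM f g :
  continuous f -> continuous g -> continuous (fun x => f x * g x).
Proof. by move=> cf cg x; apply: cvgM; [exact: cf|exact: cg]. Qed.

Lemma continuous_funX f n : continuous f -> continuous (fun x => f x ^+ n).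
Proof.
move=> cf; elim: n => [|n IH]; first exact: continuous_fun_cst.
by under eq_fun do rewrite exprS; exact: continuous_funM.
Qed.

Lemma continuous_funV f :
  (forall x, f x != 0) -> continuous f -> continuous (fun x => (f x)^-1).
Proof. by move=> f0 cf x; apply: cvgV; [exact: f0|exact: cf]. Qed.

Lemma continuous_fun_sqrt f :
  continuous f -> continuous (fun x => Num.sqrt (f x)).
Proof.
by move=> cf x; apply: continuous_comp; [exact: cf|exact: sqrt_continuous].
Qed.

Lemma is_derive_funD f g (x a b : R) : is_derive x 1 f a -> is_derive x 1 g b ->
  is_derive x 1 (fun t => f t + g t) (a + b).
Proof. by move=> df dg; exact: is_deriveD. Qed.

Lemma is_derive_funN f (x a : R) : is_derive x 1 f a ->
  is_derive x 1 (fun t => - f t) (- a).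
Proof. by move=> df; exact: is_deriveN. Qed.

Lemma is_derive_funM f g (x a b : R) : is_derive x 1 f a -> is_derive x 1 g b ->
  is_derive x 1 (fun t => f t * g t) (f x * b + g x * a).
Proof. by move=> df dg; exact: is_deriveM. Qed.

Lemma is_derive_funX f n (x a : R) : is_derive x 1 f a ->
  is_derive x 1 (fun t => f t ^+ n) (n%:R * f x ^+ n.-1 * a).
Proof.
move=> df; rewrite (_ : (fun t => f t ^+ n) = f ^+ n); first exact: is_deriveX.
by apply/funext => t; rewrite exprfctE.
Qed.

Lemma is_derive_fun_comp F f (x a b : R) : is_derive x 1 f a ->
  is_derive (f x) 1 F b -> is_derive x 1 (fun t => F (f t)) (b * a).
Proof. by move=> df dF; exact: (is_derive1_comp dF df). Qed.

Lemma is_derive_funV f (x a : R) : f x != 0 -> is_derive x 1 f a ->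
  is_derive x 1 (fun t => (f t)^-1) (- (f x) ^- 2 * a).
Proof. by move=> fx0 df; exact: is_deriveV. Qed.

Lemma is_derive_fun_sqrt f (x a : R) : 0 < f x -> is_derive x 1 f a ->
  is_derive x 1 (fun t => Num.sqrt (f t)) ((2 * Num.sqrt (f x))^-1 * a).
Proof.
by move=> fx0 df; apply: is_derive_fun_comp; exact: is_derive1_sqrt.
Qed.

Lemma is_derive_continuous F f : (forall x : R, is_derive x 1 F (f x)) -> continuous F.
Proof.
move=> dF x; apply: differentiable_continuous; apply/derivable1_diffP.
exact: ex_derive.
Qed.

Lemma derive1_is_derive F f : (forall x : R, is_derive x 1 F (f x)) -> derive1 F = f.
Proof. by move=> dF; apply/funext => x; rewrite derive1E; apply: derive_val. Qed.

Lemma is_derive_LRcontinuous F f (a b : R) :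
  (forall x : R, is_derive x 1 F (f x)) -> derivable_oo_LRcontinuous F a b.
Proof.
move=> dF; have cF := is_derive_continuous dF; split.
- by move=> x _; exact: ex_derive.
- exact: cvg_at_right_filter (cF a).
- exact: cvg_at_left_filter (cF b).
Qed.

Lemma continuous_itv_integrable f (a b : R) : continuous f ->
  (@lebesgue_measure R).-integrable `[a, b] (EFin \o f).
Proof.
move=> cf; apply: continuous_compact_integrable; first exact: segment_compact.
exact: continuous_subspaceT.
Qed.

(** Differentiability on the closed segment, ends included, supplies the one-sided
continuity of [F] that the fundamental theorem asks for. *)
Lemma Rintegral_FTC F f (a b : R) : a < b -> continuous f ->
  (forall x : R, x \in `[a, b] -> is_derive x 1 F (f x)) ->
  \int[lebesgue_measure]_(x in `[a, b]) f x = F b - F a.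
Proof.
move=> ab cf dF.
have cF x : x \in `[a, b] -> {for x, continuous F}.
  move=> /dF ?; apply: differentiable_continuous; apply/derivable1_diffP.
  exact: ex_derive.
rewrite /Rintegral (@continuous_FTC2 R f F a b)//.
- exact: continuous_subspaceT.
- split.
  + by move=> x /subset_itv_oo_cc/dF ?; exact: ex_derive.
  + by apply: cvg_at_right_filter; apply: cF; rewrite in_itv/= lexx ltW.
  + by apply: cvg_at_left_filter; apply: cF; rewrite in_itv/= lexx ltW.
- by move=> x /subset_itv_oo_cc/dF ?; rewrite derive1E; exact: derive_val.
Qed.

Lemma continuous_powR (r x : R) : 0 < x -> {for x, continuous (fun t : R => t `^ r)}.
Proof.
move=> x0; apply: differentiable_continuous; apply/derivable1_diffP.
by apply: derivable_powR; rewrite in_itv/= andbT.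
Qed.

Lemma continuous_powR_comp (g : R -> R) (r x : R) : continuous g -> 0 < g x ->
  {for x, continuous (fun t : R => g t `^ r)}.
Proof.
by move=> cg gx0; exact: (continuous_comp (cg x) (@continuous_powR r _ gx0)).
Qed.

End Calculus.

(** * Substitution with integrands that are singular at the ends *)

Section Substitution.
Context {R : realType}.
Implicit Types f g F G : R -> R.
Local Notation mu := (@lebesgue_measure R).

Lemma gt0_is_derive_homo F f (a b : R) :
  (forall x : R, is_derive x 1 F (f x)) ->
  (forall x, x \in `]a, b[ -> 0 < f x) ->
  {in `[a, b] &, {homo F : x y / x < y}}.
Proof.
move=> dF f0; apply: (@gtr0_derive1_lt_cc R F a b).
- by move=> x _; exact: ex_derive.
- by move=> x xab; rewrite (derive1_is_derive dF) f0.
- exact/continuous_subspaceT/(is_derive_continuous dF).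
Qed.

Lemma increasing_image_itvcc F (a b : R) : a < b -> continuous F ->
  {in `[a, b] &, {homo F : x y / x < y}} ->
  `[F a, F b]%classic = F @` `[a, b]%classic.
Proof.
move=> ab cF homoF.
have aab : a \in `[a, b] by rewrite in_itv/= lexx ltW.
have bab : b \in `[a, b] by rewrite in_itv/= lexx ltW.
have leF : F a <= F b by apply/ltW/homoF.
rewrite eqEsubset; split=> [y /= yF|_ [x /= xab <-]].
  have [|||x xab <-] := @IVT R F a b y; [exact: ltW| | |by exists x].
    exact: continuous_subspaceT.
  by rewrite min_l// max_r.
have wF : {in `[a, b] &, {homo F : x y / x <= y}}.
  by move=> u v uab vab; rewrite le_eqVlt => /predU1P[->//|uv]; apply/ltW/homoF.
by have := xab; rewrite !in_itv/= => /andP[ax xb]; rewrite !wF.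
Qed.

Lemma increasing_image_itvoo F (a b : R) : a < b -> continuous F ->
  {in `[a, b] &, {homo F : x y / x < y}} ->
  `]F a, F b[%classic = F @` `]a, b[%classic.
Proof.
move=> ab cF homoF; have imF := increasing_image_itvcc ab cF homoF.
have aab : a \in `[a, b] by rewrite in_itv/= lexx ltW.
have bab : b \in `[a, b] by rewrite in_itv/= lexx ltW.
rewrite eqEsubset; split=> [y /= yF|_ [x /= xab <-]]; last first.
  have xab' := subset_itv_oo_cc xab.
  by move: xab; rewrite !in_itv/= => /andP[ax xb]; rewrite !homoF.
have : (F @` `[a, b]%classic) y by rewrite -imF; exact: subset_itv_oo_cc yF.
move=> [x /= + xy]; move: yF; rewrite -xy !in_itv/= => /andP[Fax xFb] /andP[ax xb].
exists x => //=; rewrite in_itv/= !lt_neqAle ax xb !andbT.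
by apply/andP; split; apply/eqP => e; move: Fax xFb; rewrite e ltxx.
Qed.

(** On each segment [[a n, b n]] this is the change of variables for continuous
integrands.  As [G] is nonnegative, both sides are monotone limits of the
integrals over the segments and over their images, so [G] may blow up at the
ends of [E]. *)
Lemma ge0_substitution_exhaust F f G (a b : R^nat) (D E : set R) :
  (forall n, a n < b n) -> nonincreasing_seq a -> nondecreasing_seq b ->
  D = \bigcup_n `[a n, b n]%classic -> E = F @` D ->
  (forall x : R, is_derive x 1 F (f x)) -> continuous f ->
  (forall x, D x -> 0 < f x) ->
  (forall x, E x -> {for x, continuous G}) ->
  (forall x, E x -> 0 <= G x) ->
  (\int[mu]_(x in E) (G x)%:E = \int[mu]_(x in D) (G (F x) * f x)%:E)%E.
Proof.
move=> ab na nb DE ED dF cf f0 cG G0.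
have cF := is_derive_continuous dF.
have subD n x : x \in `[a n, b n] -> D x by move=> xab; rewrite DE; exists n.
have homoF n : {in `[a n, b n] &, {homo F : x y / x < y}}.
  by apply: gt0_is_derive_homo dF _ => x /subset_itv_oo_cc/subD/f0.
have imF n := increasing_image_itvcc (ab n) cF (homoF n).
have EE : E = \bigcup_n `[F (a n), F (b n)]%classic.
  by rewrite ED DE image_bigcup; apply: eq_bigcupr => n _; rewrite imF.
have subE n x : x \in `[F (a n), F (b n)] -> E x.
  by move=> xF; rewrite EE; exists n.
have DF x : D x -> E (F x) by move=> Dx; rewrite ED; exists x.
have step n : (\int[mu]_(x in `[F (a n), F (b n)]) (G x)%:E =
    \int[mu]_(x in `[a n, b n]) (G (F x) * f x)%:E)%E.
  rewrite (@integration_by_substitution_increasing R F G _ _ (ltW (ab n)))//.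
  - by rewrite (derive1_is_derive dF).
  - by rewrite (derive1_is_derive dF) => x _.
  - rewrite (derive1_is_derive dF); apply/cvg_ex; exists (f (a n)).
    exact: cvg_at_right_filter (cf _).
  - rewrite (derive1_is_derive dF); apply/cvg_ex; exists (f (b n)).
    exact: cvg_at_left_filter (cf _).
  - exact: is_derive_LRcontinuous dF.
  - by apply: continuous_in_subspaceT => x; rewrite inE/= => /subE/cG.
have mG n : measurable_fun `[F (a n), F (b n)] (fun x => (G x)%:E).
  apply/measurable_EFinP; apply: subspace_continuous_measurable_fun => //.
  by apply: continuous_in_subspaceT => x; rewrite inE/= => /subE/cG.
have mGF n : measurable_fun `[a n, b n] (fun x => (G (F x) * f x)%:E).
  apply/measurable_EFinP; apply: subspace_continuous_measurable_fun => //.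
  apply: continuous_in_subspaceT => x; rewrite inE/= => /subD Dx.
  apply: cvgM; last exact: cf.
  by apply: continuous_comp; [exact: cF|apply: cG; exact: DF].
have mono m n : (m <= n)%N ->
    (`[a m, b m]%classic `<=` `[a n, b n]%classic).
  move=> mn x /=; rewrite !in_itv/= => /andP[amx xbm].
  by rewrite (le_trans _ amx) ?na// (le_trans xbm)// nb.
have limD : (\int[mu]_(x in `[a n, b n]) (G (F x) * f x)%:E @[n --> \oo] -->
    \int[mu]_(x in \bigcup_n `[a n, b n]%classic) (G (F x) * f x)%:E)%E.
  apply: ge0_nondecreasing_set_cvg_integral => //.
    by move=> m n mn; rewrite subsetEset; exact: mono.
  move=> n x /subD Dx; rewrite lee_fin mulr_ge0 ?(ltW (f0 _ Dx))//.
  exact/G0/DF.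
have limE : (\int[mu]_(x in `[F (a n), F (b n)]) (G x)%:E @[n --> \oo] -->
    \int[mu]_(x in \bigcup_n `[F (a n), F (b n)]%classic) (G x)%:E)%E.
  apply: ge0_nondecreasing_set_cvg_integral => //.
    by move=> m n mn; rewrite subsetEset !imF; apply/image_subset/mono.
  by move=> n x /subE Ex; rewrite lee_fin G0.
rewrite {1}EE {1}DE.
rewrite -(cvg_lim (@ereal_hausdorff R) limD) -(cvg_lim (@ereal_hausdorff R) limE).
by under eq_fun do rewrite step.
Qed.

(** The division by n + 3 makes the segments nondegenerate from n = 0 on. *)
Lemma itvoo_exhaust (a b : R) : a < b ->
  let d n := (b - a) / n.+3%:R in
  [/\ forall n, a + d n < b - d n, nonincreasing_seq (fun n => a + d n),
      nondecreasing_seq (fun n => b - d n) &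
      `]a, b[%classic = \bigcup_n `[a + d n, b - d n]%classic].
Proof.
move=> ab d.
have d0 n : 0 < d n by rewrite divr_gt0// subr_gt0.
have dmono m n : (m <= n)%N -> d n <= d m.
  by move=> mn; rewrite ler_pM2l ?subr_gt0// lef_pV2 ?posrE// ler_nat.
split.
- move=> n; have : d n <= (b - a) / 3 by apply: (dmono 0%N n).
  by lra.
- by move=> m n mn; rewrite lerD2l dmono.
- by move=> m n mn; rewrite lerD2l lerN2 dmono.
rewrite eqEsubset; split => [x /=|x [n _] /=]; rewrite !in_itv/=; last first.
  by move=> /andP[h1 h2]; have := d0 n; move=> ?; apply/andP; split; lra.
move=> /andP[ax xb]; pose e := Num.min (x - a) (b - x).
have e0 : 0 < e by rewrite lt_min !subr_gt0 ax.
exists (Num.truncn ((b - a) / e)) => //=; rewrite in_itv/=.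
set n := Num.truncn _.
have dne : d n <= e.
  rewrite ler_pdivrMr// mulrC -ler_pdivrMr//.
  apply: ltW; apply: lt_trans (truncnS_gt _) _.
  by rewrite ltr_nat -/n ltnS ltnW.
move: dne; rewrite le_min => /andP[h1 h2]; apply/andP; split; lra.
Qed.

Lemma itv0y_exhaust :
  let a n := n.+1%:R^-1 : R in let b n := n.+2%:R : R in
  [/\ forall n, a n < b n, nonincreasing_seq a,
      nondecreasing_seq b &
      `]0, +oo[%classic = \bigcup_n `[a n, b n]%classic].
Proof.
split.
- move=> n; apply: (@le_lt_trans _ _ 1); last by rewrite ltr1n.
  by rewrite invf_le1// ler1n.
- by move=> m n mn; rewrite lef_pV2 ?posrE// ler_nat ltnS.
- by move=> m n mn; rewrite ler_nat !ltnS.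
rewrite eqEsubset; split => [x /=|x [n _] /=]; rewrite !in_itv/=; last first.
  by move=> /andP[h1 h2]; rewrite andbT (lt_le_trans _ h1)// invr_gt0.
rewrite andbT => x0.
exists (maxn (Num.truncn x) (Num.truncn x^-1)) => //=; rewrite in_itv/=.
apply/andP; split.
  rewrite -[leRHS]invrK lef_pV2 ?posrE ?invr_gt0//.
  apply: le_trans (ltW (truncnS_gt _)) _.
  by rewrite ler_nat ltnS leq_maxr.
apply: le_trans (ltW (truncnS_gt _)) _.
by rewrite ler_nat !ltnS (leq_trans (leq_maxl _ (Num.truncn x^-1)))// leqnSn.
Qed.

Lemma ge0_substitution_itvoo F f G (a b : R) : a < b ->
  (forall x : R, is_derive x 1 F (f x)) -> continuous f ->
  (forall x, x \in `]a, b[ -> 0 < f x) ->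
  (forall x, x \in `]F a, F b[ -> {for x, continuous G}) ->
  (forall x, x \in `]F a, F b[ -> 0 <= G x) ->
  (\int[mu]_(x in `[F a, F b]) (G x)%:E = \int[mu]_(x in `[a, b]) (G (F x) * f x)%:E)%E.
Proof.
move=> ab dF cf f0 cG G0; have cF := is_derive_continuous dF.
have imF := increasing_image_itvoo ab cF (gt0_is_derive_homo dF f0).
have Fim x : x \in `]a, b[ -> F x \in `]F a, F b[.
  move=> xab; have : (F @` `]a, b[%classic) (F x) by exists x.
  by rewrite -imF.
rewrite [LHS]integral_itv_bndoo; last first.
  apply/measurable_EFinP; apply: open_continuous_measurable_fun => // x.
  by rewrite inE/=; exact: cG.
rewrite [RHS]integral_itv_bndoo; last first.
  apply/measurable_EFinP; apply: open_continuous_measurable_fun => // x.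
  rewrite inE /= => xab; apply: cvgM; last exact: cf.
  by apply: continuous_comp; [exact: cF|apply: cG; exact: Fim].
have [h1 h2 h3 h4] := itvoo_exhaust ab.
exact: (ge0_substitution_exhaust h1 h2 h3 h4 imF).
Qed.

(** In the applications the factor [f] vanishes where [G] blows up, and [g] is the
product with the singularity cancelled: its continuity makes the right-hand side
a proper integral. *)
Lemma Rintegral_substitution_itvoo F f G g (a b : R) : a < b ->
  (forall x : R, is_derive x 1 F (f x)) -> continuous f ->
  (forall x, x \in `]a, b[ -> 0 < f x) ->
  (forall x, x \in `]F a, F b[ -> {for x, continuous G}) ->
  (forall x, x \in `]F a, F b[ -> 0 <= G x) ->
  continuous g -> (forall x, x \in `]a, b[ -> G (F x) * f x = g x) ->
  \int[mu]_(x in `[F a, F b]) G x = \int[mu]_(x in `[a, b]) g x.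
Proof.
move=> ab dF cf f0 cG G0 cg Gg; have cF := is_derive_continuous dF.
rewrite /Rintegral (ge0_substitution_itvoo ab dF cf f0 cG G0); congr fine.
have imF := increasing_image_itvoo ab cF (gt0_is_derive_homo dF f0).
have Fim x : x \in `]a, b[ -> F x \in `]F a, F b[.
  move=> xab; have : (F @` `]a, b[%classic) (F x) by exists x.
  by rewrite -imF.
rewrite [LHS]integral_itv_bndoo; last first.
  apply/measurable_EFinP; apply: open_continuous_measurable_fun => // x.
  rewrite inE /= => xab; apply: cvgM; last exact: cf.
  by apply: continuous_comp; [exact: cF|apply: cG; exact: Fim].
rewrite [RHS]integral_itv_bndoo; last first.
  by apply/measurable_EFinP; exact: open_continuous_measurable_fun.
by apply: eq_integral => x; rewrite inE/= => xab; rewrite Gg.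
Qed.

End Substitution.

(** * Values of the Gamma function *)

Section GammaValues.
Context {R : realType}.
Local Notation mu := (@lebesgue_measure R).

Lemma continuous_gamma_integrand (s x : R) : 0 < x ->
  {for x, continuous (fun t => t `^ s * expR (- t))}.
Proof.
move=> x0.
apply: cvgM; first exact: continuous_powR.
by apply: continuous_comp; [exact: cvgN|exact: continuous_expR].
Qed.

(** At t = 0 the integrand may be singular; removing that point makes the
integrand continuous. *)
Lemma Gamma_itvoy (s : R) : Gamma s =
  fine (\int[mu]_(t in `]0%R, +oo[) (t `^ (s - 1) * expR (- t))%:E)%E.
Proof.
rewrite /Gamma /Rintegral integral_itv_obnd_cbnd//.
apply/measurable_EFinP; apply: open_continuous_measurable_fun => // x.
by rewrite inE/= in_itv/= andbT => x0; exact: continuous_gamma_integrand.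
Qed.

Lemma gamma_integral_parts (s a b : R) : 0 < a -> a < b ->
  (\int[mu]_(t in `[a, b]) (t `^ s * expR (- t))%:E =
   s%:E * \int[mu]_(t in `[a, b]) (t `^ (s - 1) * expR (- t))%:E +
   (a `^ s * expR (- a) - b `^ s * expR (- b))%:E)%E.
Proof.
move=> a0 ab.
have pos x : x \in `[a, b] -> 0 < x.
  by rewrite in_itv/= => /andP[/(lt_le_trans a0)].
have cont (r : R) : {within `[a, b], continuous (fun t => t `^ r * expR (- t))}.
  apply: continuous_in_subspaceT => x; rewrite inE/= => /pos.
  exact: continuous_gamma_integrand.
have int (r : R) : mu.-integrable `[a, b] (fun t => (t `^ r * expR (- t))%:E).
  by apply: continuous_compact_integrable; [exact: segment_compact|exact: cont].
pose F := fun t : R => - (t `^ s * expR (- t)).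
pose f := fun t : R => t `^ s * expR (- t) - s * (t `^ (s - 1) * expR (- t)).
have dF (x : R) : 0 < x -> is_derive x 1 F (f x).
  move=> x0; rewrite /F /f; apply: is_derive_eq.
    by apply: is_derive_funN; apply: is_derive_funM; first exact: is_derive1_powR.
  by rewrite /=; ring.
have cF (x : R) : 0 < x -> {for x, continuous F}.
  move=> x0; apply: differentiable_continuous; apply/derivable1_diffP.
  by have := dF _ x0 => d; exact: ex_derive.
have cf : {within `[a, b], continuous f}.
  apply: continuous_in_subspaceT => x; rewrite inE/= => /pos x0.
  apply: cvgB; first exact: continuous_gamma_integrand.
  by apply: cvgM; [exact: cvg_cst|exact: continuous_gamma_integrand].
transitivity (\int[mu]_(t in `[a, b])
    (s%:E * (t `^ (s - 1) * expR (- t))%:E + (f t)%:E))%E.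
  by apply: eq_integral => t _; rewrite -EFinM -EFinD /f addrC subrK.
rewrite integralD//=; first last.
- by apply: continuous_compact_integrable; [exact: segment_compact|exact: cf].
- by apply: integrableZl => //; exact: int.
rewrite integralZl//.
rewrite (@continuous_FTC2 R f F a b ab cf).
- by rewrite -EFinB /F; congr (_ + _%:E)%E; ring.
- split.
  + by move=> x /subset_itv_oo_cc/pos/dF ?; exact: ex_derive.
  + by apply: cvg_at_right_filter; exact: cF.
  + by apply: cvg_at_left_filter; apply: cF; apply: lt_trans ab.
- move=> x /subset_itv_oo_cc/pos/dF ?; rewrite derive1E; exact: derive_val.
Qed.

(** Integrate by parts on [1/(n+1), n+2] and let n grow.  The restriction s <= 1
keeps the boundary term at infinity elementary: t^s exp(-t) is then at most
t exp(-t), hence at most 2/t. *)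
Lemma Gamma_rec (s : R) : 0 < s -> s <= 1 -> Gamma (s + 1) = s * Gamma s.
Proof.
move=> s0 s1; rewrite !Gamma_itvoy addrK.
have [ab na nb DE] := @itv0y_exhaust R.
set a := fun n => n.+1%:R^-1 in ab na DE; set b := fun n => n.+2%:R in ab nb DE.
have a0 n : 0 < a n by rewrite invr_gt0.
have lim (r : R) : (\int[mu]_(t in `[a n, b n]) (t `^ r * expR (- t))%:E @[n --> \oo] -->
   \int[mu]_(t in `]0%R, +oo[) (t `^ r * expR (- t))%:E)%E.
  rewrite DE; apply: ge0_nondecreasing_set_cvg_integral => //.
  - move=> m n mn; rewrite subsetEset => x/=; rewrite !in_itv/= => /andP[h1 h2].
    by rewrite (le_trans _ h1) ?na// (le_trans h2)// nb.
  - move=> n; apply/measurable_EFinP; apply: subspace_continuous_measurable_fun => //.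
    apply: continuous_in_subspaceT => x; rewrite inE/= in_itv/= => /andP[h _].
    by apply: continuous_gamma_integrand; apply: lt_le_trans h.
  - by move=> n x _; rewrite lee_fin mulr_ge0// ?powR_ge0// expR_ge0.
pose c n : R := a n `^ s * expR (- a n) - b n `^ s * expR (- b n).
have c0 : c n @[n --> \oo] --> (0 : R).
  have ca : a n @[n --> \oo] --> (0 : R) by exact: cvg_harmonic.
  have c1 : a n `^ s * expR (- a n) @[n --> \oo] --> (0 : R).
    apply: (@squeeze_cvgr _ _ _ _ (fun=> 0) (fun n => a n `^ s)).
    - apply: nearW => n; rewrite mulr_ge0 ?powR_ge0 ?expR_ge0//=.
      by rewrite ger_pMr ?powR_gt0// expR_le1 oppr_le0 ltW.
    - exact: cvg_cst.
    - by have /cvg_at_rightP := powR_cvg0 s0; apply; split.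
  have c2 : b n `^ s * expR (- b n) @[n --> \oo] --> (0 : R).
    apply: (@squeeze_cvgr _ _ _ _ (fun=> 0) (fun n => 2 * a n)).
    - apply: nearW => n; rewrite mulr_ge0 ?powR_ge0 ?expR_ge0//=.
      have b1 : 1 <= b n by rewrite ler1n.
      have h1 : b n `^ s <= b n by exact: ler1_powR.
      have h2 : 1 + b n ^+ 2 / 2 <= expR (b n) by apply: (expR_ge1Dxn 1); lra.
      have h3 : 1 <= b n * a n by rewrite ler_pdivlMr ?mul1r ?ler_nat.
      rewrite expRN ler_pdivrMr ?expR_gt0//.
      have := a0 n; move: h1 h2 h3 b1; set u := _ `^ _; set e := expR _.
      move: (b n) (a n) => B A h1 h2 h3 b1 A0.
      apply: (le_trans h1); apply: (@le_trans _ _ (2 * A * (B ^+ 2 / 2))).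
        have -> : 2 * A * (B ^+ 2 / 2) = B * (B * A) by field.
        by rewrite ler_peMr//; lra.
      by rewrite ler_pM2l; lra.
    - exact: cvg_cst.
    - by rewrite -[X in _ --> X](mulr0 2); apply: cvgM; [exact: cvg_cst|].
  by rewrite -[X in _ --> X](subr0 0); exact: cvgB c1 c2.
have e1 := lim s.
have e2 : (s%:E * \int[mu]_(t in `[a n, b n]) (t `^ (s - 1) * expR (- t))%:E + (c n)%:E
   @[n --> \oo] --> s%:E * \int[mu]_(t in `]0%R, +oo[) (t `^ (s - 1) * expR (- t))%:E + 0)%E.
  apply: cvgeD; first by rewrite fin_num_adde_defl.
    by apply: cvgeZl => //; exact: lim.
  by apply: cvg_EFin => //; apply: nearW.
rewrite adde0 in e2.
rewrite -(cvg_lim (@ereal_hausdorff R) e1).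
under eq_fun do rewrite (gamma_integral_parts _ (a0 _) (ab _)).
rewrite (cvg_lim (@ereal_hausdorff R) e2).
(* [fine] sends infinite values to 0, so the identity also survives divergence *)
case: (X in fine (_ * X)) => [x| |].
- by [].
- by rewrite gt0_muley ?lte_fin//= mulr0.
- by rewrite gt0_muleNy ?lte_fin//= mulr0.
Qed.

Lemma Gamma1 : Gamma (1 : R) = 1.
Proof.
rewrite /Gamma; under eq_Rintegral => t _ do rewrite subrr powRr0 mul1r.
have cexp : continuous (fun t : R => expR (- t)).
  by move=> x; apply: continuous_comp; [exact: cvgN|exact: continuous_expR].
have d (x : R) : is_derive x 1 (fun t : R => - expR (- t)) (expR (- x)).
  apply: is_derive_eq.
  by rewrite /GRing.scale/=; ring.
rewrite (@Rintegral_ge0_continuous_FTC2y R _ (fun t => - expR (- t)) 0 0).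
- by rewrite oppr0 expR0 sub0r opprK.
- by move=> x _; exact: expR_ge0.
- exact: continuous_subspaceT.
- by rewrite -[X in _ --> X]oppr0; apply: cvgN; exact: cvgr_expR.
- by move=> x _; exact: ex_derive.
- by apply: cvg_at_right_filter; apply: cvgN; exact: cexp.
- by move=> x _; rewrite (derive1_is_derive d).
Qed.

(** With t = v^2 this is twice the Gaussian integral over the half-line. *)
Lemma Gamma_half : Gamma (2^-1 : R) = Num.sqrt pi.
Proof.
rewrite Gamma_itvoy.
have [ab na nb DE] := @itv0y_exhaust R.
have sq : `]0, +oo[%classic = (fun t : R => t ^+ 2) @` `]0, +oo[%classic.
  rewrite eqEsubset; split => [x/=|_ [x/= + <-]]; rewrite !in_itv/= !andbT => x0.
    by exists (Num.sqrt x); rewrite ?in_itv/= ?andbT ?sqrtr_gt0// sqr_sqrtr// ltW.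
  by rewrite exprn_gt0.
have d (x : R) : is_derive x 1 (fun t : R => t ^+ 2) (2 * x).
  apply: is_derive_eq.
  by rewrite /GRing.scale/=; ring.
rewrite (ge0_substitution_exhaust ab na nb DE sq d).
- transitivity (fine (\int[mu]_(x in `]0%R, +oo[) (2%:E * (gauss_fun x)%:E))%E).
    congr fine; apply: eq_integral => x; rewrite inE/= in_itv/= andbT => x0.
    rewrite -EFinM; congr EFin; rewrite /gauss_fun.
    have -> : 2^-1 - 1 = - 2^-1 :> R by field.
    rewrite powRN powR12_sqrt ?exprn_ge0 ?ltW// sqrtr_sqr gtr0_norm//.
    by field; rewrite gt_eqF.
  rewrite integral_itv_obnd_cbnd; last first.
    apply/measurable_EFinP; apply: measurable_funM => //.
    by apply: measurable_funTS; exact: measurable_gauss_fun.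
  rewrite ge0_integralZl_EFin//.
  + by rewrite integral0y_gauss/= mulrC divfK.
  + by move=> x _; rewrite lee_fin gauss_fun_ge0.
  + by apply/measurable_EFinP; apply: measurable_funTS; exact: measurable_gauss_fun.
- by apply: continuous_funM; [exact: continuous_fun_cst|exact: continuous_fun_id].
- by move=> x /=; rewrite in_itv/= andbT => x0; rewrite mulr_gt0.
- by move=> x /=; rewrite in_itv/= andbT => x0; exact: continuous_gamma_integrand.
- by move=> x _; rewrite mulr_ge0 ?powR_ge0 ?expR_ge0.
Qed.

End GammaValues.

(** * The Appell function from Euler's integral *)

Section AppellIntegral.
Context {R : realType}.
Implicit Types x y t : R.
Local Notation mu := (@lebesgue_measure R).

Lemma pihalf_gt0 : 0 < pi / 2 :> R.
Proof. by rewrite divr_gt0// pi_gt0. Qed.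

Lemma sin_gt0_itvoo t : t \in `]0, (pi / 2)[ -> 0 < sin t.
Proof. by rewrite in_itv/=; exact: sin_gt0_pihalf. Qed.

Lemma cos_gt0_itvoo t : t \in `]0, (pi / 2)[ -> 0 < cos t.
Proof.
rewrite in_itv/= => /andP[t0 tp]; apply: cos_gt0_pihalf; rewrite tp andbT.
by rewrite (lt_trans _ t0)// oppr_lt0 pihalf_gt0.
Qed.

Lemma sin2_ge0_le1 t : 0 <= sin t ^+ 2 <= 1.
Proof. by rewrite sqr_ge0 sin2cos2 lerBlDr lerDl sqr_ge0. Qed.

Lemma onem_mul_sin2_gt0 y t : y < 1 -> 0 < 1 - y * sin t ^+ 2.
Proof.
have := sin2_ge0_le1 t; move: (sin t ^+ 2) => s /andP[s0 s1] y1.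
by have [->|sn0] := eqVneq s 0; [lra|have ? : 0 < s by rewrite lt_neqAle eq_sym sn0 s0]; nra.
Qed.

(** Exchanges sine and cosine in integrals over the quarter period. *)
Lemma Rintegral_reflect (f : R -> R) : continuous f ->
  \int[mu]_(t in `[0, pi / 2]) f (pi / 2 - t) = \int[mu]_(t in `[0, pi / 2]) f t.
Proof.
move=> cf; pose F t := pi / 2 - t.
have dF (t : R) : is_derive t 1 F (- 1).
  by rewrite /F -[- 1]add0r; apply: is_derive_funD.
have := @integration_by_substitution_decreasing R F f 0 (pi / 2).
have -> : F (pi / 2) = 0 by rewrite /F subrr.
have -> : F 0 = pi / 2 by rewrite /F subr0.
rewrite (derive1_is_derive dF) /Rintegral => ->//.
- by congr fine; apply: eq_integral => t _; rewrite /F !fctE opprK mulr1.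
- exact/ltW/pihalf_gt0.
- by move=> u v _ _; rewrite /F ltrD2l ltrN2.
- by move=> ? _; exact: cvg_cst.
- exact: is_cvg_cst.
- exact: is_cvg_cst.
- exact: is_derive_LRcontinuous dF.
- exact: continuous_subspaceT.
Qed.

Lemma continuous_onem_mul (a : R) : continuous (fun t : R => 1 - a * t).
Proof.
apply: continuous_funD; first exact: continuous_fun_cst.
apply: continuous_funN; apply: continuous_funM; first exact: continuous_fun_cst.
exact: continuous_fun_id.
Qed.

Lemma continuous_sin2 : continuous (fun t : R => sin t ^+ 2).
Proof. exact: continuous_funX (@continuous_sin R). Qed.

Lemma continuous_onem_sin2 y : continuous (fun t : R => 1 - y * sin t ^+ 2).
Proof.
apply: continuous_funD; first exact: continuous_fun_cst.
apply: continuous_funN; apply: continuous_funM; first exact: continuous_fun_cst.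
exact: continuous_sin2.
Qed.

(** Up to the factor 4/pi, Euler's integrand for F1(1/2; 1, 1/2; 2 | x, y) after
u = sin^2 t: the singular weight u^(-1/2) (1 - u)^(1/2) du becomes
2 cos^2 t dt. *)
Definition appell_trig x y t : R :=
  cos t ^+ 2 / ((1 - x * sin t ^+ 2) * Num.sqrt (1 - y * sin t ^+ 2)).

Lemma continuous_appell_trig x y : x < 1 -> y < 1 -> continuous (appell_trig x y).
Proof.
move=> x1 y1; apply: continuous_funM.
  exact: continuous_funX (@continuous_cos R).
apply: continuous_funV => [t|].
  by rewrite mulf_neq0// gt_eqF ?sqrtr_gt0 ?onem_mul_sin2_gt0.
apply: continuous_funM; first exact: continuous_onem_sin2.
exact/continuous_fun_sqrt/continuous_onem_sin2.
Qed.

Lemma appellF1_integral_trig x y : x < 1 -> y < 1 ->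
  appellF1_integral (1 / 2) 1 (1 / 2) 2 x y =
  4 / pi * \int[mu]_(t in `[0, pi / 2]) appell_trig x y t.
Proof.
move=> x1 y1; rewrite /appellF1_integral.
have pi0 := pi_gt0 R.
have -> : Gamma (2 : R) = 1 by rewrite -natr1 Gamma_rec// Gamma1 mulr1.
have -> : 2 - 1 / 2 = 2^-1 + 1 :> R by field.
rewrite Gamma_rec ?invr_gt0//; last by rewrite invf_le1// ler1n.
rewrite div1r Gamma_half addrK.
have d (t : R) : is_derive t 1 (fun t : R => sin t ^+ 2) (2 * sin t * cos t).
  by apply: is_derive_eq; rewrite /GRing.scale/=; ring.
have cg := continuous_appell_trig x1 y1.
have := @Rintegral_substitution_itvoo R _ _
  (fun u => u `^ (2^-1 - 1) * (1 - u) `^ 2^-1 / ((1 - x * u) `^ 1 * (1 - y * u) `^ 2^-1))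
  (fun t => 2 * appell_trig x y t) 0 (pi / 2) pihalf_gt0 d.
rewrite sin0 sin_pihalf expr0n/= expr1n => ->.
- rewrite RintegralZl//; last exact: continuous_itv_integrable.
  move: (Rintegral _ _ _) => I.
  have : Num.sqrt pi ^+ 2 = pi :> R by rewrite sqr_sqrtr ?ltW.
  have : 0 < Num.sqrt pi :> R by rewrite sqrtr_gt0.
  move: (Num.sqrt pi) => q q0 <-.
  by field; rewrite gt_eqF.
- apply: continuous_funM; last exact: continuous_cos.
  by apply: continuous_funM; [exact: continuous_fun_cst|exact: continuous_sin].
- by move=> t tI; rewrite !mulr_gt0// ?sin_gt0_itvoo ?cos_gt0_itvoo.
- move=> u; rewrite in_itv/= => /andP[u0 u1].
  apply: cvgM; first apply: cvgM; first exact: continuous_powR.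
    apply: (continuous_powR_comp (g := fun t => 1 - t)); last by rewrite subr_gt0.
    apply: continuous_funD; first exact: continuous_fun_cst.
    by apply: continuous_funN; exact: continuous_fun_id.
  have hx : 0 < 1 - x * u by nra.
  have hy : 0 < 1 - y * u by nra.
  apply: cvgV; first by rewrite mulf_neq0// gt_eqF ?powR_gt0.
  apply: cvgM.
    by apply: (continuous_powR_comp (g := fun t => 1 - x * t)) => //; exact: continuous_onem_mul.
  by apply: (continuous_powR_comp (g := fun t => 1 - y * t)) => //; exact: continuous_onem_mul.
- by move=> u _; rewrite !mulr_ge0 ?invr_ge0 ?mulr_ge0 ?powR_ge0.
- by apply: continuous_funM => //; exact: continuous_fun_cst.
move=> t tI; have s0 := sin_gt0_itvoo tI; have c0 := cos_gt0_itvoo tI.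
have hx : 0 < 1 - x * sin t ^+ 2 by exact: onem_mul_sin2_gt0.
have hy : 0 < 1 - y * sin t ^+ 2 by exact: onem_mul_sin2_gt0.
have -> : 2^-1 - 1 = - 2^-1 :> R by field.
rewrite powRN -cos2sin2 !powR12_sqrt ?sqr_ge0 ?(ltW hy)// powRr1 ?(ltW hx)//.
rewrite !sqrtr_sqr !gtr0_norm// /appell_trig; field.
by rewrite !gt_eqF ?sqrtr_gt0.
Qed.

End AppellIntegral.

(** * Sums and uniform limits under the integral *)

Section UniformLimits.
Context {R : realType}.
Implicit Types (t : R) (n N : nat).
Local Notation mu := (@lebesgue_measure R).

Lemma continuous_fun_sum (f : nat -> R -> R) N : (forall n, continuous (f n)) ->
  continuous (fun t => \sum_(0 <= n < N) f n t).
Proof.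
move=> cf; elim: N => [|N IH].
  by under eq_fun do rewrite big_geq//; exact: continuous_fun_cst.
by under eq_fun do rewrite big_nat_recr//=; exact: continuous_funD.
Qed.

Lemma Rintegral_sum (f : nat -> R -> R) (a b : R) N : (forall n, continuous (f n)) ->
  \int[mu]_(t in `[a, b]) (\sum_(0 <= n < N) f n t) =
  \sum_(0 <= n < N) \int[mu]_(t in `[a, b]) f n t.
Proof.
move=> cf; elim: N => [|N IH].
  rewrite big_geq// (@eq_Rintegral _ _ _ _ _ (fun=> 0)).
    by rewrite Rintegral_cst// mul0r.
  by move=> t _; rewrite big_geq.
rewrite big_nat_recr//= -IH -RintegralD//.
- by apply: eq_Rintegral => t _; rewrite big_nat_recr.
- exact/continuous_itv_integrable/continuous_fun_sum.
- exact: continuous_itv_integrable.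
Qed.

Lemma cvg_error_bound (u e : nat -> R) (l : R) :
  (forall n, `|u n - l| <= e n) -> e n @[n --> \oo] --> 0 -> u n @[n --> \oo] --> l.
Proof.
move=> ul e0; apply: (@squeeze_cvgr _ _ _ _ (fun n => l - e n) (fun n => l + e n)).
- by apply: nearW => n; rewrite -ler_distlC distrC.
- by rewrite -[X in _ --> X]subr0; apply: cvgB => //; exact: cvg_cst.
- by rewrite -[X in _ --> X]addr0; apply: cvgD => //; exact: cvg_cst.
Qed.

(** Uniform convergence with an explicit error is all that the termwise
integrations need: the singular weights have been removed by the trigonometric
substitution, so every integrand is continuous on a segment. *)
Lemma cvg_Rintegral_uniform (f : nat -> R -> R) (g : R -> R) (e : nat -> R) (a b : R) :
  (forall n, continuous (f n)) -> continuous g -> a < b ->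
  (forall n t, t \in `[a, b] -> `|f n t - g t| <= e n) ->
  e n @[n --> \oo] --> 0 ->
  \int[mu]_(t in `[a, b]) f n t @[n --> \oo] --> \int[mu]_(t in `[a, b]) g t.
Proof.
move=> cf cg ab fge e0.
apply: (@cvg_error_bound _ (fun n => e n * (b - a))); last first.
  by rewrite -[X in _ --> X](mul0r (b - a)); apply: cvgM => //; exact: cvg_cst.
move=> n.
have cfg : continuous (fun t => f n t - g t).
  by apply: continuous_funD => //; exact: continuous_funN.
rewrite -RintegralB//; try exact: continuous_itv_integrable.
apply: le_trans (le_normr_Rintegral _ _) _ => //.
  exact: (continuous_itv_integrable (f := fun t => f n t - g t)).
have -> : e n * (b - a) = \int[mu]_(t in `[a, b]) e n.
  rewrite mulrBr; apply/esym/(@Rintegral_FTC R (fun t => e n * t) (fun=> e n) a b ab).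
    exact: continuous_fun_cst.
  by move=> t _; apply: is_derive_eq; rewrite /GRing.scale/=; ring.
apply: le_Rintegral => //.
- apply: (continuous_itv_integrable (f := fun t => `|f n t - g t|)).
  by move=> x; apply: cvg_norm; exact: cfg.
- exact: (continuous_itv_integrable a b (@continuous_fun_cst R (e n))).
- by move=> t tab; exact: fge.
Qed.

End UniformLimits.

(** * The binomial series of (1 - z)^(-1/2) *)

Section BinomialSeries.
Context {R : realType}.
Implicit Types (z r : R) (n N : nat).

(** The coefficient of z^n in the expansion of (1 - z)^(-1/2). *)
Definition binom_half n : R := pochhammer (1 / 2) n / n`!%:R.

Lemma binom_halfS n : n.+1%:R * binom_half n.+1 = (n%:R + 1 / 2) * binom_half n.
Proof.
rewrite /binom_half /pochhammer big_ord_recr/= factS natrM.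
have f0 : n`!%:R != 0 :> R by rewrite pnatr_eq0 -lt0n fact_gt0.
have n0 : n.+1%:R != 0 :> R by [].
by move: (n.+1%:R) (n`!%:R) n0 f0 => a b a0 b0; field; rewrite a0 b0.
Qed.

Lemma binom_half_ge0_le1 n : 0 <= binom_half n <= 1.
Proof.
elim: n => [|n /andP[h0 h1]].
  by rewrite /binom_half /pochhammer big_ord0 fact0 divr1 ler01 lexx.
have n0 : 0 < n.+1%:R :> R by [].
have -> : binom_half n.+1 = (n%:R + 1 / 2) / n.+1%:R * binom_half n.
  by rewrite mulrAC -binom_halfS mulrAC divff ?mul1r// gt_eqF.
have c0 : 0 <= (n%:R + 1 / 2) / n.+1%:R :> R by rewrite divr_ge0// addr_ge0.
rewrite mulr_ge0//= mulr_ile1//.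
by rewrite ler_pdivrMr// [leRHS]mul1r -[leRHS]natr1 lerD2l; lra.
Qed.

Definition binom_half_sum N z : R := \sum_(0 <= n < N) binom_half n * z ^+ n.

Definition binom_half_dsum N z : R :=
  \sum_(0 <= n < N) binom_half n * (n%:R * z ^+ n.-1).

Lemma is_derive_binom_half_sum N z :
  is_derive z 1 (binom_half_sum N) (binom_half_dsum N z).
Proof.
rewrite /binom_half_sum /binom_half_dsum; elim: N => [|N IH].
  by under eq_fun do rewrite big_geq//; rewrite big_geq//; exact: is_derive_cst.
under eq_fun do rewrite big_nat_recr//=; rewrite big_nat_recr//=.
apply: is_derive_funD; apply: is_derive_eq.
  by apply: is_derive_funM; exact: (is_derive_funX N (is_derive_id z 1)).
by rewrite /=; ring.
Qed.

(** The full series solves (1 - z) S' = S / 2.  For a partial sum the coefficient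
recurrence telescopes and leaves only the last term. *)
Lemma binom_half_ode N z :
  (1 - z) * binom_half_dsum N z =
  binom_half_sum N z / 2 - N%:R * binom_half N * z ^+ N.-1.
Proof.
rewrite /binom_half_sum /binom_half_dsum; elim: N => [|N IH].
  by rewrite !big_geq//; ring.
rewrite !big_nat_recr//= mulrDr IH binom_halfS.
by case: N {IH} => [|N]/=; rewrite ?exprS; field.
Qed.

(** By the differential equation, sqrt (1 - u z) S_N(u z) has derivative
- z N a_N (u z)^(N-1) / sqrt (1 - u z) in u, where a_N <= 1 and N = n + 1; this is
at most N r^N / sqrt (1 - r) in absolute value.  The mean value theorem on [0, 1]
compares u = 1 with u = 0, where the function is 1 because N > 0.  Moving along
the segment from 0 to z treats both signs of z at once. *)
Lemma binom_half_sum_error n z r : `|z| <= r -> r < 1 ->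
  `|binom_half_sum n.+1 z - (Num.sqrt (1 - z))^-1| <= n.+1%:R * r ^+ n.+1 / (1 - r).
Proof.
set N := n.+1.
move=> zr r1; have r0 : 0 <= r := le_trans (normr_ge0 _) zr.
have uz (u : R) : u \in `[0, 1] -> `|u * z| <= r.
  by rewrite in_itv/= => /andP[u0 u1]; rewrite normrM ger0_norm// (le_trans _ zr)// ler_piMl.
have gap (u : R) : u \in `[0, 1] -> 1 - r <= 1 - u * z.
  by move=> /uz; rewrite ler_norml => /andP[_ h]; lra.
have gap0 (u : R) : u \in `[0, 1] -> 0 < 1 - u * z by move=> /gap h; lra.
have z1 : 1 - r <= 1 - z by have := gap 1; rewrite mul1r => ->//; rewrite in_itv/= ler01 lexx.
pose phi u := Num.sqrt (1 - u * z) * binom_half_sum N (u * z).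
pose dphi u := - (z * (N%:R * binom_half N * (u * z) ^+ N.-1) / Num.sqrt (1 - u * z)).
have dphiE (u : R) : u \in `[0, 1] -> is_derive u 1 phi (dphi u).
  move=> uI; have g0 := gap0 u uI.
  have duz : is_derive u 1 (fun u => u * z) z.
    by apply: is_derive_eq; rewrite /GRing.scale/=; ring.
  have d1 : is_derive u 1 (fun u => 1 - u * z) (- z).
    by rewrite -[- z]add0r; apply: is_derive_funD; exact: is_derive_funN.
  have d2 := is_derive_fun_sqrt (f := fun u => 1 - u * z) g0 d1.
  have d3 := is_derive_fun_comp (f := fun u => u * z) duz (is_derive_binom_half_sum N (u * z)).
  have d4 := is_derive_funM d2 d3; apply: (is_derive_eq d4).
  have q0 : 0 < Num.sqrt (1 - u * z) by rewrite sqrtr_gt0.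
  have qE : Num.sqrt (1 - u * z) ^+ 2 = 1 - u * z by rewrite sqr_sqrtr// ltW.
  have := binom_half_ode N (u * z); rewrite -[X in X * _ = _]qE /dphi.
  move: (Num.sqrt _) (binom_half_dsum _ _) (binom_half_sum _ _) q0 => q D S q0 ode.
  have -> : N%:R * binom_half N * (u * z) ^+ N.-1 = S / 2 - q ^+ 2 * D by rewrite ode; ring.
  by field; rewrite gt_eqF.
have cphi : {within `[0, 1], continuous phi}.
  by apply: derivable_within_continuous => u uI; have d := dphiE u uI; exact: ex_derive.
have dphiE' (u : R) : u \in `]0, 1[ -> is_derive u 1 phi (dphi u).
  by move=> /subset_itv_oo_cc; exact: dphiE.
have [u uI phiE] := MVT_segment ler01 dphiE' cphi; move: phiE.
rewrite subr0 mulr1 => phiE.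
have phi0 : phi 0 = 1.
  rewrite /phi mul0r subr0 sqrtr1 mul1r /binom_half_sum /N.
  rewrite big_nat_recl//= big1 ?addr0; last by move=> i _; rewrite expr0n mulr0.
  by rewrite expr0 mulr1 /binom_half /pochhammer big_ord0 fact0 divr1.
have q0 : 0 < Num.sqrt (1 - z) by rewrite sqrtr_gt0; lra.
have -> : binom_half_sum N z - (Num.sqrt (1 - z))^-1 = dphi u / Num.sqrt (1 - z).
  by rewrite -phiE phi0 /phi mul1r; field; rewrite gt_eqF.
have p0 : 0 < Num.sqrt (1 - u * z) by rewrite sqrtr_gt0 gap0.
have r10 : 0 < 1 - r by lra.
have w0 : 0 < Num.sqrt (1 - r) by rewrite sqrtr_gt0.
have /andP[b0 b1] := binom_half_ge0_le1 N.
have numer : `|z * (N%:R * binom_half N * (u * z) ^+ n)| <= N%:R * r ^+ N.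
  move: (binom_half N) b0 b1 => c c0 c1.
  rewrite normrM normrM normrM normrX (ger0_norm c0) (ger0_norm (ler0n _ _)).
  rewrite /N exprS [leRHS]mulrCA ler_pM ?mulr_ge0 ?exprn_ge0//.
  rewrite ler_pM ?mulr_ge0 ?exprn_ge0//; first by rewrite ler_piMr.
  by rewrite lerXn2r ?nnegrE// uz.
rewrite /dphi mulNr normrN -(mulrA _ (Num.sqrt _)^-1) -invfM normrM normfV.
rewrite ler_pM// lef_pV2 ?posrE ?normr_gt0 ?mulf_neq0 ?gt_eqF//.
rewrite gtr0_norm ?mulr_gt0//.
have -> : 1 - r = Num.sqrt (1 - r) * Num.sqrt (1 - r) by rewrite -expr2 sqr_sqrtr ?ltW.
by rewrite ler_pM ?(ltW w0)// ler_wsqrtr// gap.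
Qed.

(** Splitting r^n as q^n q^n with q = sqrt r, the factor n q^n is bounded by
1 / (1 - q), being at most the sum of the n first powers of q. *)
Lemma cvg_mulrn_expr r : 0 <= r -> r < 1 -> n%:R * r ^+ n @[n --> \oo] --> (0 : R).
Proof.
move=> r0 r1; pose q := Num.sqrt r.
have q0 : 0 <= q by exact: sqrtr_ge0.
have q1 : q < 1 by rewrite -sqrtr1 ltr_sqrt.
have qn n : n%:R * q ^+ n * (1 - q) <= 1 - q ^+ n.
  elim: n => [|n IH]; first by rewrite mul0r mul0r expr0 subrr.
  have qn0 : 0 <= q ^+ n by exact: exprn_ge0.
  rewrite -natr1 exprS.
  have : q * (n%:R * q ^+ n * (1 - q)) <= q * (1 - q ^+ n) by rewrite ler_wpM2l.
  have : 0 <= (1 - q) * (1 - q * q ^+ n).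
    rewrite mulr_ge0// subr_ge0 ?(ltW q1)// mulr_ile1 ?(ltW q1)//.
    by rewrite exprn_ile1// ltW.
  by move: (n%:R) (q ^+ n) => a b; lra.
apply: (@squeeze_cvgr _ _ _ _ (fun=> 0) (fun n => (1 - q)^-1 * q ^+ n)).
- apply: nearW => n; rewrite mulr_ge0 ?exprn_ge0//=.
  rewrite -[in leLHS](sqr_sqrtr r0) -/q -exprM mulnC exprM expr2 mulrA.
  rewrite ler_wpM2r ?exprn_ge0// -[leRHS]mul1r ler_pdivlMr ?subr_gt0//.
  by rewrite (le_trans (qn n))// gerBl exprn_ge0.
- exact: cvg_cst.
- rewrite -[X in _ --> X](mulr0 (1 - q)^-1); apply: cvgM; first exact: cvg_cst.
  by apply: cvg_expr; rewrite ger0_norm.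
Qed.

End BinomialSeries.

(** * The Appell function from its double series *)

Section AppellSeries.
Context {R : realType}.
Implicit Types (x y z t r : R) (n m N : nat).
Local Notation mu := (@lebesgue_measure R).

(** The derivative of cos^3 t sin^(2n+1) t integrates to 0 over the quarter period,
which gives the recurrence (2n + 4) m_(n+1) = (2n + 1) m_n between consecutive
moments; it is also the one satisfied by the quotient of Pochhammer symbols. *)
Lemma wallis_moment n :
  4 / pi * \int[mu]_(t in `[0, pi / 2]) (cos t ^+ 2 * (sin t ^+ 2) ^+ n) =
  pochhammer (1 / 2) n / pochhammer 2 n :> R.
Proof.
have pi0 := pi_gt0 R.
have cI m : continuous (fun t : R => cos t ^+ 2 * (sin t ^+ 2) ^+ m).
  apply: continuous_funM; first exact/continuous_funX/continuous_cos.
  exact/continuous_funX/continuous_sin2.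
elim: n => [|n IH].
  transitivity (4 / pi * ((pi / 2 + sin (pi / 2) * cos (pi / 2)) / 2
    - (0 + sin 0 * cos 0) / 2) : R).
    congr (_ * _); apply: (@Rintegral_FTC R (fun t => (t + sin t * cos t) / 2)
      _ _ _ pihalf_gt0 (cI 0%N)) => t _.
    by apply: is_derive_eq; have := cos2Dsin2 t; rewrite /GRing.scale/= expr0 mulr1; lra.
  rewrite sin_pihalf cos_pihalf sin0 mulr0 mul0r !addr0 mul0r subr0.
  by rewrite /pochhammer !big_ord0; move: pi pi0 => p p0; field; rewrite gt_eqF.
(* the integrand is the derivative of cos^3 t sin^(2n+1) t *)
have : \int[mu]_(t in `[0, pi / 2])
    ((2 * n%:R + 1) * (cos t ^+ 2 * (sin t ^+ 2) ^+ n)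
     - (2 * n%:R + 4) * (cos t ^+ 2 * (sin t ^+ 2) ^+ n.+1)) = 0 :> R.
  pose F t := cos t ^+ 3 * sin t * (sin t ^+ 2) ^+ n.
  transitivity (F (pi / 2) - F 0); last first.
    by rewrite /F cos_pihalf sin0 expr0n/= !(mul0r, mulr0) subr0.
  apply: (@Rintegral_FTC R F _ _ _ pihalf_gt0).
  - apply: continuous_funD; [|apply: continuous_funN];
      by apply: continuous_funM => //; exact: continuous_fun_cst.
  move=> t _; rewrite {}/F.
  have dc : is_derive t 1 (fun t => cos t ^+ 3 * sin t)
    (cos t ^+ 4 - 3 * cos t ^+ 2 * sin t ^+ 2).
    by apply: is_derive_eq; rewrite /GRing.scale/=; ring.
  have ds : is_derive t 1 (fun t : R => sin t ^+ 2) (2 * sin t * cos t).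
    by apply: is_derive_eq; rewrite /GRing.scale/=; ring.
  apply: is_derive_eq.
    by apply: is_derive_funM; exact: (is_derive_funX n ds).
  case: n IH => [|n] _ /=; first by rewrite !expr0; have := cos2Dsin2 t; nra.
  apply: subr0_eq; transitivity ((2 * n%:R + 3) * cos t ^+ 2 * sin t ^+ 2
    * (sin t ^+ 2) ^+ n * (cos t ^+ 2 - (1 - sin t ^+ 2))).
    by rewrite !(exprS (sin t ^+ 2)) -[n.+1%:R]natr1; ring.
  by rewrite cos2sin2 subrr mulr0.
rewrite RintegralB//; first last.
- by apply/continuous_itv_integrable/continuous_funM => //; exact: continuous_fun_cst.
- by apply/continuous_itv_integrable/continuous_funM => //; exact: continuous_fun_cst.
rewrite !RintegralZl//; try exact: continuous_itv_integrable.
move=> /eqP; rewrite subr_eq0 => /eqP rec.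
have nn0 : 0 <= n%:R :> R by [].
transitivity ((2 * n%:R + 1) / (2 * n%:R + 4) * (pochhammer (1 / 2) n / pochhammer 2 n) : R).
  rewrite -IH mulrCA; congr (_ * _); rewrite mulrAC rec mulrAC.
  by rewrite divff ?mul1r// gt_eqF//; lra.
rewrite /pochhammer !big_ord_recr/=.
have P0 : 0 < \prod_(i < n) (2 + i%:R) :> R.
  by apply: prodr_gt0 => i _; rewrite ltr_pwDl.
by field; rewrite !gt_eqF//=; lra.
Qed.

(** The density whose moments against the powers of sin^2 t are (1/2)_n / (2)_n. *)
Definition appell_weight t : R := 4 / pi * cos t ^+ 2.

Lemma continuous_appell_weight : continuous appell_weight.
Proof.
apply: continuous_funM; first exact: continuous_fun_cst.
exact/continuous_funX/continuous_cos.
Qed.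

Lemma appell_weight_ge0_le t : 0 <= appell_weight t <= 4 / pi.
Proof.
have p0 : 0 < 4 / pi :> R by rewrite divr_gt0// pi_gt0.
rewrite /appell_weight mulr_ge0 ?sqr_ge0 ?(ltW p0)//= ler_piMr ?(ltW p0)//.
Qed.

Lemma norm_mul_sin2 x t : `|x * sin t ^+ 2| <= `|x|.
Proof.
have /andP[s0 s1] := sin2_ge0_le1 t.
by rewrite normrM (ger0_norm s0) ler_piMr.
Qed.

Lemma continuous_mul_sin2X x n : continuous (fun t : R => (x * sin t ^+ 2) ^+ n).
Proof.
apply: continuous_funX; apply: continuous_funM; first exact: continuous_fun_cst.
exact: continuous_sin2.
Qed.

Lemma continuous_binom_half_sum N : continuous (@binom_half_sum R N).
Proof.
apply: continuous_fun_sum => n.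
by apply: continuous_funM; [exact: continuous_fun_cst|exact/continuous_funX/continuous_fun_id].
Qed.

Lemma pochhammer1 n : pochhammer (1 : R) n = n`!%:R.
Proof.
rewrite /pochhammer; elim: n => [|n IH]; first by rewrite big_ord0.
by rewrite big_ord_recr/= IH factS mulnC natrM -[in RHS]natr1 [n%:R + 1]addrC.
Qed.

Definition appell_term x y m n : R :=
  pochhammer (1 / 2) (m + n) * pochhammer 1 m * pochhammer (1 / 2) n
    / (pochhammer 2 (m + n) * m`!%:R * n`!%:R) * x ^+ m * y ^+ n.

Lemma appell_term_integral x y m n : appell_term x y m n =
  \int[mu]_(t in `[0, pi / 2])
    (appell_weight t * (x * sin t ^+ 2) ^+ m * (binom_half n * (y * sin t ^+ 2) ^+ n)).
Proof.
have cI : continuous (fun t : R => cos t ^+ 2 * (sin t ^+ 2) ^+ (m + n)).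
  apply: continuous_funM; first exact/continuous_funX/continuous_cos.
  exact/continuous_funX/continuous_sin2.
transitivity (x ^+ m * y ^+ n * binom_half n * (4 / pi) * \int[mu]_(t in `[0, pi / 2])
  (cos t ^+ 2 * (sin t ^+ 2) ^+ (m + n))).
  rewrite -[RHS]mulrA wallis_moment /appell_term pochhammer1 /binom_half.
  have f0 k : k`!%:R != 0 :> R by rewrite pnatr_eq0 -lt0n fact_gt0.
  have P0 : pochhammer 2 (m + n) != 0 :> R.
    by apply/prodf_neq0 => i _; rewrite gt_eqF// ltr_wpDr.
  by field; rewrite P0 !f0.
rewrite -RintegralZl//; last exact: continuous_itv_integrable.
by apply: eq_Rintegral => t _; rewrite /appell_weight !exprMn exprD; ring.
Qed.

(** Summing over n first leaves the factor (x sin^2 t)^m outside, bounded by 1, and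
a binomial series in y sin^2 t. *)
Lemma appell_inner_series x y m : `|x| < 1 -> `|y| < 1 ->
  limn (series (appell_term x y m)) =
  \int[mu]_(t in `[0, pi / 2])
    (appell_weight t / Num.sqrt (1 - y * sin t ^+ 2) * (x * sin t ^+ 2) ^+ m).
Proof.
move=> x1 y1; have y1' : y < 1 by exact: le_lt_trans (ler_norm _) y1.
pose f N t := appell_weight t * (x * sin t ^+ 2) ^+ m * binom_half_sum N (y * sin t ^+ 2).
have cf N : continuous (f N).
  apply: continuous_funM.
    apply: continuous_funM; first exact: continuous_appell_weight.
    exact: continuous_mul_sin2X.
  move=> t; apply: continuous_comp; last exact: continuous_binom_half_sum.
  by have := @continuous_mul_sin2X y 1; exact.
have -> : series (appell_term x y m) = fun N => \int[mu]_(t in `[0, pi / 2]) f N t.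
  apply/funext => N; rewrite /series/=.
  under eq_bigr => n _ do rewrite appell_term_integral.
  rewrite -Rintegral_sum; last first.
    move=> n; apply: continuous_funM.
      apply: continuous_funM; first exact: continuous_appell_weight.
      exact: continuous_mul_sin2X.
    apply: continuous_funM; first exact: continuous_fun_cst.
    exact: continuous_mul_sin2X.
  by apply: eq_Rintegral => t _; rewrite /f /binom_half_sum big_distrr.
have cq : continuous (fun t => (Num.sqrt (1 - y * sin t ^+ 2))^-1).
  apply: continuous_funV; last exact/continuous_fun_sqrt/continuous_onem_sin2.
  by move=> t; rewrite gt_eqF// sqrtr_gt0 onem_mul_sin2_gt0.
apply/cvg_lim => //; rewrite -cvg_shiftS/=.
apply: (@cvg_Rintegral_uniform _ _ _
    (fun n => 4 / pi / (1 - `|y|) * (n.+1%:R * `|y| ^+ n.+1)) _ _ _ _ pihalf_gt0) => //.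
- apply: continuous_funM; last exact: continuous_mul_sin2X.
  by apply: continuous_funM => //; exact: continuous_appell_weight.
- move=> n t _; have /andP[w0 w1] := appell_weight_ge0_le t.
  have -> : f n.+1 t - appell_weight t / Num.sqrt (1 - y * sin t ^+ 2) * (x * sin t ^+ 2) ^+ m
    = appell_weight t * (x * sin t ^+ 2) ^+ m *
      (binom_half_sum n.+1 (y * sin t ^+ 2) - (Num.sqrt (1 - y * sin t ^+ 2))^-1).
    by rewrite /f; ring.
  rewrite normrM -(mulrA (4 / pi)) ler_pM//.
    rewrite normrM normrX (ger0_norm w0) -[leRHS]mulr1 ler_pM ?exprn_ge0//.
    by rewrite exprn_ile1// (le_trans (norm_mul_sin2 _ _))// ltW.
  by rewrite [leRHS]mulrC; apply: binom_half_sum_error => //; exact: norm_mul_sin2.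
rewrite -[X in _ --> X](mulr0 (4 / pi / (1 - `|y|))); apply: cvgM; first exact: cvg_cst.
have := cvg_mulrn_expr (normr_ge0 y) y1.
by rewrite -cvg_shiftS.
Qed.

Lemma geometric_sum_error M z r : `|z| <= r -> r < 1 ->
  `|\sum_(0 <= m < M) z ^+ m - (1 - z)^-1| <= r ^+ M / (1 - r).
Proof.
move=> zr r1; have zr' : z <= r := le_trans (ler_norm _) zr.
have z1 : 0 < 1 - z by lra.
have -> : \sum_(0 <= m < M) z ^+ m - (1 - z)^-1 = - z ^+ M / (1 - z).
  have := subrX1 z M; rewrite big_mkord => h.
  have -> : z ^+ M = 1 + (z - 1) * \sum_(i < M) z ^+ i by rewrite -h addrC subrK.
  by field; rewrite gt_eqF.
rewrite mulNr normrN normrM normfV normrX (gtr0_norm z1).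
rewrite ler_pM ?invr_ge0 ?exprn_ge0 ?(ltW z1)//.
  by rewrite lerXn2r ?nnegrE// (le_trans (normr_ge0 z)).
by rewrite lef_pV2 ?posrE//; lra.
Qed.

(** After the inner sums, what is left under the integral is a geometric series in
x sin^2 t against a bounded continuous function. *)
Lemma appellF1_series_trig x y : `|x| < 1 -> `|y| < 1 ->
  appellF1_series (1 / 2) 1 (1 / 2) 2 x y =
  4 / pi * \int[mu]_(t in `[0, pi / 2]) appell_trig x y t.
Proof.
move=> x1 y1; have y1' : y < 1 by exact: le_lt_trans (ler_norm _) y1.
have x1' : x < 1 by exact: le_lt_trans (ler_norm _) x1.
pose h t := appell_weight t / Num.sqrt (1 - y * sin t ^+ 2).
have ch : continuous h.
  apply: continuous_funM; first exact: continuous_appell_weight.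
  apply: continuous_funV; last exact/continuous_fun_sqrt/continuous_onem_sin2.
  by move=> t; rewrite gt_eqF// sqrtr_gt0 onem_mul_sin2_gt0.
have chx m : continuous (fun t => h t * (x * sin t ^+ 2) ^+ m).
  by apply: continuous_funM => //; exact: continuous_mul_sin2X.
rewrite -RintegralZl//; last exact/continuous_itv_integrable/continuous_appell_trig.
rewrite /appellF1_series; apply/cvg_lim => //.
under eq_fun => m do rewrite -/(appell_term x y m) (appell_inner_series _ x1 y1).
have -> : series (fun m => \int[mu]_(t in `[0, pi / 2]) (h t * (x * sin t ^+ 2) ^+ m)) =
    fun M => \int[mu]_(t in `[0, pi / 2]) (h t * \sum_(0 <= m < M) (x * sin t ^+ 2) ^+ m).
  apply/funext => M; rewrite /series/= -Rintegral_sum//.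
  by apply: eq_Rintegral => t _; rewrite big_distrr.
apply: (@cvg_Rintegral_uniform _ _ _
    (fun M => 4 / pi / Num.sqrt (1 - `|y|) * (`|x| ^+ M / (1 - `|x|))) _ _ _ _ pihalf_gt0).
- move=> M; apply: continuous_funM => //.
  by apply: continuous_fun_sum => m; exact: continuous_mul_sin2X.
- apply: continuous_funM; first exact: continuous_fun_cst.
  exact: continuous_appell_trig.
- move=> M t _; have /andP[w0 w1] := appell_weight_ge0_le t.
  have xt0 := onem_mul_sin2_gt0 t x1'; have yt0 := onem_mul_sin2_gt0 t y1'.
  have -> : h t * \sum_(0 <= m < M) (x * sin t ^+ 2) ^+ m - 4 / pi * appell_trig x y t
    = h t * (\sum_(0 <= m < M) (x * sin t ^+ 2) ^+ m - (1 - x * sin t ^+ 2)^-1).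
    rewrite mulrBr; congr (_ - _); rewrite /h /appell_weight /appell_trig.
    by rewrite invfM; ring.
  rewrite normrM ler_pM//; last by apply: geometric_sum_error => //; exact: norm_mul_sin2.
  rewrite /h normrM normfV (ger0_norm w0) ler_pM ?invr_ge0//.
  have yy0 : 0 < 1 - `|y| by rewrite subr_gt0.
  rewrite ger0_norm ?sqrtr_ge0// lef_pV2 ?posrE ?sqrtr_gt0//.
  apply: ler_wsqrtr; rewrite lerD2l lerN2.
  exact: le_trans (ler_norm _) (norm_mul_sin2 _ _).
rewrite -[X in _ --> X](mulr0 (4 / pi / Num.sqrt (1 - `|y|))).
apply: cvgM; first exact: cvg_cst.
rewrite -[X in _ --> X](mul0r (1 - `|x|)^-1); apply: cvgM; last exact: cvg_cst.
by apply: cvg_expr; rewrite normr_id.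
Qed.

End AppellSeries.

(** * Complete elliptic integrals *)

Section Elliptic.
Context {R : realType}.
Implicit Types k t : R.
Local Notation mu := (@lebesgue_measure R).

(** Jacobi's delta amplitude of modulus [k]. *)
Definition Delta k t : R := Num.sqrt (1 - k ^+ 2 * sin t ^+ 2).

Lemma continuous_Delta k : continuous (Delta k).
Proof. exact/continuous_fun_sqrt/continuous_onem_sin2. Qed.

Lemma Delta_gt0 k t : 0 <= k < 1 -> 0 < Delta k t.
Proof.
by move=> /andP[k0 k1]; rewrite sqrtr_gt0 onem_mul_sin2_gt0// expr_lt1.
Qed.

Lemma sqr_Delta k t : 0 <= k < 1 -> Delta k t ^+ 2 = 1 - k ^+ 2 * sin t ^+ 2.
Proof.
move=> /andP[k0 k1]; rewrite sqr_sqrtr// ltW// onem_mul_sin2_gt0//.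
by rewrite expr_lt1.
Qed.

Lemma continuous_invDelta k : 0 <= k < 1 -> continuous (fun t => (Delta k t)^-1).
Proof.
move=> hk; apply: continuous_funV; last exact: continuous_Delta.
by move=> t; rewrite gt_eqF// Delta_gt0.
Qed.

Lemma is_derive_Delta k t : 0 <= k < 1 ->
  is_derive t 1 (Delta k) (- (k ^+ 2 * sin t * cos t) / Delta k t).
Proof.
move=> hk; have D0 := Delta_gt0 t hk.
have d : is_derive t 1 (fun t : R => 1 - k ^+ 2 * sin t ^+ 2)
    (- (k ^+ 2 * (2 * sin t * cos t))).
  by apply: is_derive_eq; rewrite /GRing.scale/=; ring.
apply: is_derive_eq.
  apply: (is_derive_fun_sqrt _ d).
  by case/andP: hk => k0 k1; rewrite onem_mul_sin2_gt0// expr_lt1.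
by rewrite -/(Delta k t); field; rewrite gt_eqF.
Qed.

(** The hypothesis on [kappa] says that it is 2 sqrt k / (1 + k) up to sign, without
mentioning sqrt k.  With s = sin t and x = (1 + k) s / (1 + k s^2),
  1 - x^2 = (1 - s^2) (1 - k^2 s^2) / (1 + k s^2)^2  and
  1 - kappa^2 x^2 = (1 - k s^2)^2 / (1 + k s^2)^2,
while dx carries the factor (1 - k s^2) cos t, so that only (1 + k) / Delta
survives.  The singularity of the integrand at x = 1 is absorbed by cos t. *)
Lemma ellipticK_landen k (kappa : R) : 0 <= k < 1 ->
  kappa ^+ 2 = 4 * k / (1 + k) ^+ 2 ->
  ellipticK kappa = (1 + k) * \int[mu]_(t in `[0, pi / 2]) (Delta k t)^-1.
Proof.
move=> hk kapE; have /andP[k0 k1] := hk; rewrite /ellipticK.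
have den_gt0 t : 0 < 1 + k * sin t ^+ 2.
  by rewrite ltr_wpDr// mulr_ge0// sqr_ge0.
have d t : is_derive t 1 (fun t : R => (1 + k) * sin t / (1 + k * sin t ^+ 2))
    ((1 + k) * (1 - k * sin t ^+ 2) * cos t / (1 + k * sin t ^+ 2) ^+ 2).
  apply: is_derive_eq.
    apply: is_derive_funM; apply: is_derive_funV; first by rewrite gt_eqF.
  by rewrite /GRing.scale/=; field; rewrite gt_eqF.
have := @Rintegral_substitution_itvoo R _ _
  (fun x => (Num.sqrt ((1 - x ^+ 2) * (1 - kappa ^+ 2 * x ^+ 2)))^-1)
  (fun t => (1 + k) * (Delta k t)^-1) 0 (pi / 2) pihalf_gt0 d.
rewrite sin0 sin_pihalf expr1n mulr0 mul0r !mulr1 divff; last by lra.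
move=> ->.
- by rewrite RintegralZl//; apply: continuous_itv_integrable; exact: continuous_invDelta.
- apply: continuous_funM.
    apply: continuous_funM; last exact: continuous_cos.
    by apply: continuous_funM; [exact: continuous_fun_cst|exact: continuous_onem_sin2].
  apply: continuous_funV => [t|]; first by rewrite expf_neq0// gt_eqF.
  apply: continuous_funX; apply: continuous_funD; first exact: continuous_fun_cst.
  by apply: continuous_funM; [exact: continuous_fun_cst|exact: continuous_sin2].
- move=> t tI; rewrite !mulr_gt0// ?invr_gt0 ?exprn_gt0 ?onem_mul_sin2_gt0 ?cos_gt0_itvoo//.
  by lra.
- move=> x; rewrite in_itv/= => /andP[x0 x1].
  have kap1 : kappa ^+ 2 <= 1.
    by rewrite kapE ler_pdivrMr ?exprn_gt0//; nra.
  apply: cvgV.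
    rewrite gt_eqF// sqrtr_gt0 mulr_gt0//; nra.
  suff : continuous (fun x : R => Num.sqrt ((1 - x ^+ 2) * (1 - kappa ^+ 2 * x ^+ 2))).
    exact.
  apply: continuous_fun_sqrt; apply: continuous_funM.
    apply: continuous_funD; first exact: continuous_fun_cst.
    by apply: continuous_funN; apply: continuous_funX; exact: continuous_fun_id.
  apply: continuous_funD; first exact: continuous_fun_cst.
  apply: continuous_funN; apply: continuous_funM; first exact: continuous_fun_cst.
  by apply: continuous_funX; exact: continuous_fun_id.
- by move=> x _; rewrite invr_ge0 sqrtr_ge0.
- by apply: continuous_funM; [exact: continuous_fun_cst|exact: continuous_invDelta].
move=> t tI; have s0 := sin_gt0_itvoo tI; have c0 := cos_gt0_itvoo tI.
have D0 := Delta_gt0 t hk; have E0 := den_gt0 t.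
have n0 : 0 < 1 - k * sin t ^+ 2 by exact: onem_mul_sin2_gt0.
have cE := cos2sin2 t; have DE := sqr_Delta t hk.
rewrite [X in Num.sqrt X](_ : _ =
  (cos t * Delta k t * (1 - k * sin t ^+ 2) / (1 + k * sin t ^+ 2) ^+ 2) ^+ 2); last first.
  rewrite !exprMn exprVn cE DE kapE.
  by field; rewrite !gt_eqF//; lra.
rewrite sqrtr_sqr gtr0_norm; last by rewrite !mulr_gt0// ?invr_gt0 ?exprn_gt0.
by field; rewrite !gt_eqF.
Qed.

(** With N = 1 - k s^2 + c D and v = (1 - k) s / N, the relations c^2 = 1 - s^2 and
D^2 = 1 - k^2 s^2 give
  N^2 + (1 - k)^2 s^2 = 2 (1 - k s^2) N  and
  v' = (1 - k) (1 + k s^2) / (D N),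
so 2 atan v has the integrand as derivative.  The same angle is
atan ((1 - k) s / (c D)), but passing to half of it keeps the argument of atan
finite at t = pi/2, where v = 1. *)
Lemma Rintegral_Pi_special k : 0 <= k < 1 ->
  \int[mu]_(t in `[0, pi / 2])
    ((1 - k) * ((1 + k * sin t ^+ 2) / ((1 - k * sin t ^+ 2) * Delta k t))) = pi / 2.
Proof.
move=> hk; have /andP[k0 k1] := hk.
pose N t := 1 - k * sin t ^+ 2 + cos t * Delta k t.
pose v t := (1 - k) * sin t / N t.
have cd t : 0 < 1 - k * sin t ^+ 2 by exact: onem_mul_sin2_gt0.
have N0 t : t \in `[0, (pi / 2)] -> 0 < N t.
  rewrite in_itv/= => /andP[t0 tp]; rewrite /N ltr_wpDr//.
  rewrite mulr_ge0// ?sqrtr_ge0//; apply: cos_ge0_pihalf; rewrite tp andbT.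
  by rewrite (le_trans _ t0)// oppr_le0 ltW// pihalf_gt0.
have dv t : t \in `[0, (pi / 2)] -> is_derive t 1 (fun t => 2 * atan (v t))
   ((1 - k) * ((1 + k * sin t ^+ 2) / ((1 - k * sin t ^+ 2) * Delta k t))).
  move=> tI; have Nt0 := N0 t tI; have D0 := Delta_gt0 t hk.
  have dD := is_derive_Delta t hk.
  have dN : is_derive t 1 N (- (2 * k * sin t * cos t) - sin t * Delta k t
       - cos t * (k ^+ 2 * sin t * cos t) / Delta k t).
    apply: is_derive_eq.
    by rewrite /GRing.scale/=; field; rewrite gt_eqF// Delta_gt0.
  have dvt : is_derive t 1 v (((1 - k) * cos t * N t - (1 - k) * sin t *
     (- (2 * k * sin t * cos t) - sin t * Delta k t
       - cos t * (k ^+ 2 * sin t * cos t) / Delta k t)) / N t ^+ 2).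
    apply: is_derive_eq.
      by apply: is_derive_funM; apply: is_derive_funV; first by rewrite gt_eqF.
    by rewrite /GRing.scale/=; field; rewrite !gt_eqF// Delta_gt0.
  apply: is_derive_eq.
  rewrite /GRing.scale/=; set X := ((1 - k) * cos t * N t - _).
  have DE := sqr_Delta t hk; have cE := cos2sin2 t; have nt0 := cd t.
  have H1 : 1 + v t ^+ 2 = 2 * (1 - k * sin t ^+ 2) / N t.
    suff H : N t ^+ 2 + ((1 - k) * sin t) ^+ 2 = 2 * (1 - k * sin t ^+ 2) * N t.
      transitivity ((N t ^+ 2 + ((1 - k) * sin t) ^+ 2) / N t ^+ 2).
        by rewrite /v; field; rewrite gt_eqF.
      by rewrite H; field; rewrite gt_eqF.
    apply: subr0_eq; transitivity (cos t ^+ 2 * Delta k t ^+ 2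
      - (1 - k * sin t ^+ 2) ^+ 2 + ((1 - k) * sin t) ^+ 2); first by rewrite /N; ring.
    by rewrite DE cE; ring.
  have H2 : X = (1 - k) * (1 + k * sin t ^+ 2) * N t / Delta k t.
    apply: subr0_eq; rewrite /X /N.
    transitivity ((1 - k) / Delta k t * (Delta k t ^+ 2 * (cos t ^+ 2 + sin t ^+ 2)
      + cos t ^+ 2 * k ^+ 2 * sin t ^+ 2
      - (1 + k * sin t ^+ 2) * (1 - k * sin t ^+ 2))).
      by field; rewrite gt_eqF.
    by rewrite DE cE; ring.
  by rewrite H1 H2; field; rewrite !gt_eqF.
rewrite (@Rintegral_FTC R (fun t => 2 * atan (v t)) _ _ _ pihalf_gt0)//.
- rewrite /v /N sin0 cos_pihalf sin_pihalf !mulr0 mul0r atan0 mulr0 subr0.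
  rewrite expr1n !mulr1 ?mul0r !addr0 divff ?atan1; [by field|by lra].
- apply: continuous_funM; first exact: continuous_fun_cst.
  apply: continuous_funM.
    apply: continuous_funD; first exact: continuous_fun_cst.
    by apply: continuous_funM; [exact: continuous_fun_cst|exact: continuous_sin2].
  apply: continuous_funV => [t|]; first by rewrite mulf_neq0// gt_eqF// Delta_gt0.
  by apply: continuous_funM; [exact: continuous_onem_sin2|exact: continuous_Delta].
Qed.

End Elliptic.

(** * The Appell function as an elliptic integral, and the formula for pi *)

Lemma appellF1_trig (R : realType) (x y : R) : x < 1 -> y < 1 ->
  appellF1 (1 / 2) 1 (1 / 2) 2 x y =
  4 / pi * \int[lebesgue_measure]_(t in `[0, pi / 2]) appell_trig x y t.
Proof.
move=> x1 y1; rewrite /appellF1; case: ifPn => [/andP[]|_].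
  exact: appellF1_series_trig.
exact: appellF1_integral_trig.
Qed.

(** For k = b^-2 the arguments are 1 / (1 - b^2) and 1 / (1 - b^4), and
sqrt (1 - k^2) / k is sqrt (b^4 - 1).  After reflection the integrand is
  (q / 2k) ((1 - k) (1 + k s^2) / ((1 - k s^2) D) - (1 - k) / D)
with q = sqrt (1 - k^2); the first term integrates to pi/2. *)
Lemma appellF1_elliptic (R : realType) (k : R) : 0 < k -> k < 1 ->
  appellF1 (1 / 2) 1 (1 / 2) 2 (- (k / (1 - k))) (- (k ^+ 2 / (1 - k ^+ 2))) =
  Num.sqrt (1 - k ^+ 2) / k *
    (1 - 2 / pi * (1 - k) * \int[lebesgue_measure]_(t in `[0, pi / 2]) (Delta k t)^-1).
Proof.
move=> k0 k1; have hk : 0 <= k < 1 by rewrite (ltW k0).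
have k21 : 0 < 1 - k ^+ 2 by rewrite subr_gt0 expr_lt1// ltW.
have pi0 := pi_gt0 R.
have x1 : - (k / (1 - k)) < 1.
  by rewrite (@lt_trans _ _ 0)// oppr_lt0 divr_gt0// subr_gt0.
have y1 : - (k ^+ 2 / (1 - k ^+ 2)) < 1.
  by rewrite (@lt_trans _ _ 0)// oppr_lt0 divr_gt0// exprn_gt0.
rewrite appellF1_trig// -Rintegral_reflect; last exact: continuous_appell_trig.
have q0 : 0 < Num.sqrt (1 - k ^+ 2) by rewrite sqrtr_gt0.
have qE : Num.sqrt (1 - k ^+ 2) ^+ 2 = 1 - k ^+ 2 by rewrite sqr_sqrtr// ltW.
set q := Num.sqrt (1 - k ^+ 2) in q0 qE *.
have cD := continuous_invDelta hk.
pose g t : R := (1 - k) * ((1 + k * sin t ^+ 2) / ((1 - k * sin t ^+ 2) * Delta k t)).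
have cg : continuous g.
  apply: continuous_funM; first exact: continuous_fun_cst.
  apply: continuous_funM.
    apply: continuous_funD; first exact: continuous_fun_cst.
    by apply: continuous_funM; [exact: continuous_fun_cst|exact: continuous_sin2].
  apply: continuous_funV => [t|].
    by rewrite mulf_neq0// gt_eqF ?Delta_gt0 ?onem_mul_sin2_gt0.
  by apply: continuous_funM; [exact: continuous_onem_sin2|exact: continuous_Delta].
transitivity (4 / pi * \int[lebesgue_measure]_(t in `[0, pi / 2])
    (q / (2 * k) * (g t - (1 - k) * (Delta k t)^-1))).
  congr (_ * _); apply: eq_Rintegral => t _; rewrite /appell_trig.
  have -> : cos (pi / 2 - t) = sin t.
    by rewrite cosB cos_pihalf sin_pihalf mul0r add0r mul1r.
  have -> : sin (pi / 2 - t) = cos t.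
    by rewrite sinB cos_pihalf sin_pihalf mul0r subr0 mul1r.
  have n0 : 0 < 1 - k * sin t ^+ 2 by exact: onem_mul_sin2_gt0.
  have D0 := Delta_gt0 t hk; have DE := sqr_Delta t hk.
  have -> : Num.sqrt (1 - - (k ^+ 2 / (1 - k ^+ 2)) * cos t ^+ 2) = Delta k t / q.
    rewrite -[RHS]gtr0_norm ?divr_gt0// -sqrtr_sqr exprMn exprVn qE DE cos2sin2.
    by congr Num.sqrt; field; rewrite gt_eqF.
  have -> : 1 - - (k / (1 - k)) * cos t ^+ 2 = (1 - k * sin t ^+ 2) / (1 - k).
    by rewrite cos2sin2; field; lra.
  by have k10 : 0 < 1 - k; [rewrite subr_gt0|rewrite /g; field; rewrite !gt_eqF].
have c1 : continuous (fun t : R => (1 - k) * (Delta k t)^-1).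
  by apply: continuous_funM => //; exact: continuous_fun_cst.
rewrite RintegralZl//; last first.
  apply: (continuous_itv_integrable (f := fun t => g t - (1 - k) * (Delta k t)^-1)).
  by apply: continuous_funD => //; exact: continuous_funN.
rewrite RintegralB//; try exact: continuous_itv_integrable.
have -> : \int[lebesgue_measure]_(t in `[0, pi / 2]) g t = pi / 2.
  exact: Rintegral_Pi_special hk.
rewrite RintegralZl//; last exact: continuous_itv_integrable.
move: (Rintegral _ _ _) => J; move: pi pi0 => p p0.
by field; rewrite !gt_eqF.
Qed.

Lemma Rintegral_invDelta_gt0 (R : realType) (k : R) : 0 <= k < 1 ->
  0 < \int[lebesgue_measure]_(t in `[0, pi / 2]) (Delta k t)^-1.
Proof.
move=> hk; have p0 := @pihalf_gt0 R.
apply: (lt_le_trans p0).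
have e : pi / 2 = \int[lebesgue_measure]_(t in `[0, pi / 2]) 1 :> R.
  rewrite -[LHS]subr0; apply/esym/(@Rintegral_FTC R (fun t => t) (fun=> 1) _ _ p0).
  exact: continuous_fun_cst.
rewrite [leLHS]e; apply: le_Rintegral => //.
- exact: (continuous_itv_integrable 0 (pi / 2) (@continuous_fun_cst R 1)).
- exact/continuous_itv_integrable/continuous_invDelta.
move=> t _; rewrite invf_ge1 ?Delta_gt0// -[leRHS]sqrtr1 ler_wsqrtr//.
by rewrite gerBl mulr_ge0// sqr_ge0.
Qed.

Unset Implicit Arguments.
Set Strict Implicit.

Theorem corollary3p8 (R : realType) (b : R) (hb : 1 < b) :
  pi = 2 * (b ^+ 2 - 1) ^+ 2 / Num.sqrt (b ^+ 4 - 1) *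
       (ellipticK (2 * b / (1 + b ^+ 2)) /
        (Num.sqrt (b ^+ 4 - 1) -
         appellF1 (1 / 2) 1 (1 / 2) 2 (1 / (1 - b ^+ 2)) (1 / (1 - b ^+ 4)))).
Proof.
pose k := b ^- 2.
have b0 : 0 < b by apply: lt_trans hb.
have b21 : 1 < b ^+ 2 by rewrite expr_gt1// ltW.
have b41 : 1 < b ^+ 4 by rewrite expr_gt1// ltW.
have k0 : 0 < k by rewrite invr_gt0 exprn_gt0.
have k1 : k < 1 by rewrite invf_lt1// exprn_gt0.
have hk : 0 <= k < 1 by rewrite (ltW k0).
have pi0 := pi_gt0 R.
have -> : 1 / (1 - b ^+ 2) = - (k / (1 - k)).
  by rewrite /k; field; rewrite gt_eqF//=; lra.
have -> : 1 / (1 - b ^+ 4) = - (k ^+ 2 / (1 - k ^+ 2)).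
  by rewrite /k; field; rewrite gt_eqF//=; lra.
rewrite (appellF1_elliptic k0 k1) (ellipticK_landen hk); last first.
  by rewrite /k; field; rewrite gt_eqF//=; lra.
have q0 : 0 < Num.sqrt (b ^+ 4 - 1) by rewrite sqrtr_gt0 subr_gt0.
have qE : Num.sqrt (b ^+ 4 - 1) ^+ 2 = b ^+ 4 - 1 by rewrite sqr_sqrtr// subr_ge0 ltW.
have -> : Num.sqrt (1 - k ^+ 2) / k = Num.sqrt (b ^+ 4 - 1).
  have -> : b ^+ 4 - 1 = (b ^+ 2) ^+ 2 * (1 - k ^+ 2) by rewrite /k; field; rewrite gt_eqF.
  by rewrite sqrtrM ?sqr_ge0// sqrtr_sqr gtr0_norm ?exprn_gt0// invrK mulrC.
(* from here on only the positivity of the elliptic integral J matters *)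
have := Rintegral_invDelta_gt0 hk.
move: (Rintegral _ _ _) => J J0.
move: (Num.sqrt _) q0 qE => q q0 qE; move: pi pi0 => p p0.
have -> : q - q * (1 - 2 / p * (1 - k) * J) = q * (2 / p * (1 - k) * J) by ring.
(* q ^+ 2 stays symbolic for the final rational identity, which holds for any nonzero q *)
transitivity (p * ((b ^+ 4 - 1) / q ^+ 2)); first by rewrite qE divff ?mulr1// gt_eqF//; lra.
by rewrite /k; field; rewrite !gt_eqF// subr_gt0.
Qed.
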